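(* Let $r\in\mathbb{N}$, $x\in\mathbb{C}$, and $\lambda\in\mathbb{C}$ with $|\lambda|<1$. For every integer $n\geq 1$, $$D_x\Phi^{B,r}_{M,\lambda}(-n,x)=M_n\Phi^{B,r}_{M,\lambda}(-(n-1),x)$$ and $$D_x\Phi^{E,r}_{M,\lambda}(-n,x)=M_n\Phi^{E,r}_{M,\lambda}(-(n-1),x).$$ When $n=0$, $$D_x\Phi^{B,r}_{M,\lambda}(0,x)=0\quad\text{and}\quad D_x\Phi^{E,r}_{M,\lambda}(0,x)=0.$$
   Context: $\mathbb{N}=\{1,2,\ldots\}$, $\mathbb{N}_0=\{0,1,2,\ldots\}$. For $n\ge 0$, $M_n=2^n-1$. The M-factorial is $M_0!=1$ and $M_n!=M_nM_{n-1}\cdots M_1$ for $n\geq 1$. The M-exponential is $e_M^{xt}=\sum_{n=0}^{\infty}\frac{x^nt^n}{M_n!}$, and $e_M^t$ denotes the case $x=1$. For $m\in\mathbb{N}_0$ the Mersenne translation polynomials $P_{n,M}(x;m)$ are defined by $e_M^{xt}\left(e_M^t\right)^m=\sum_{n=0}^{\infty}P_{n,M}(x;m)\frac{t^n}{M_n!}$, where $(e_M^t)^m$ is the ordinary $m$-fold product. For $r\in\mathbb{N}$, $n\in\mathbb{N}_0$, $x\in\mathbb{C}$ and $|\lambda|<1$, the Bernoulli-type and Euler-type Mersenne-Lerch interpolation values of order $r$ at $-n$ are the (convergent) series $\Phi^{B,r}_{M,\lambda}(-n,x)=\sum_{m=0}^{\infty}\binom{m+r-1}{m}\lambda^mP_{n,M}(x;m)$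 and $\Phi^{E,r}_{M,\lambda}(-n,x)=\sum_{m=0}^{\infty}(-1)^m\binom{m+r-1}{m}\lambda^mP_{n,M}(x;m)$, where $\binom{m+r-1}{m}$ is the ordinary binomial coefficient and $\lambda^0=1$. The M-derivative (acting in the variable $x$) is $D_xf(x)=\frac{f(2x)-f(x)}{x}$ for $x\neq 0$, and $D_xf(0)=\lim_{x\to 0}D_xf(x)$ whenever the limit exists. *)

(* Defs.v *)
From Stdlib Require Import Reals Lra Lia FunctionalExtensionality.
From Coquelicot Require Import Coquelicot.
Open Scope C_scope.

Definition Mersenne (n : nat) : R := (2 ^ n - 1)%R.

Fixpoint Mfact (n : nat) : R :=
  match n with
  | O => 1%R
  | S k => (Mersenne (S k) * Mfact k)%R
  end.

(** The generating function of the translation polynomials is read as an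
    identity of formal power series, a series being its sequence of
    coefficients: [a n] is the coefficient of [t^n]. *)

Definition fps := nat -> C.

Definition fps_one : fps := fun n => match n with O => 1 | S _ => 0 end.

Definition fps_mul (a b : fps) : fps :=
  fun n => sum_n (fun k => a k * b (n - k)%nat) n.

Fixpoint fps_pow (a : fps) (m : nat) : fps :=
  match m with
  | O => fps_one
  | S k => fps_mul a (fps_pow a k)
  end.

(** [Mexp x] is e_M^{xt}, as a series in [t]. *)
Definition Mexp (x : C) : fps := fun n => x ^ n / Mfact n.

(** [Ptrans n x m] is P_{n,M}(x;m). *)
Definition Ptrans (n : nat) (x : C) (m : nat) : C :=
  Mfact n * fps_mul (Mexp x) (fps_pow (Mexp 1) m) n.

Lemma Mersenne_pos n : (1 <= n)%nat -> (0 < Mersenne n)%R.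
Proof.
intros Hn; unfold Mersenne.
pose proof (Rlt_pow 2 0 n ltac:(lra) ltac:(lia)) as H.
simpl in H; lra.
Qed.

Lemma Mfact_pos n : (0 < Mfact n)%R.
Proof.
induction n as [|n IH]; simpl; [lra|].
apply Rmult_lt_0_compat; [apply Mersenne_pos; lia | exact IH].
Qed.

(** [Ptrans] is the only family satisfying the defining identity
    e_M^{xt} (e_M^t)^m = sum_n P_{n,M}(x;m) t^n / M_n!. *)
Lemma Ptrans_spec (P : nat -> C -> nat -> C) :
  (forall x m,
     fps_mul (Mexp x) (fps_pow (Mexp 1) m) = (fun n => P n x m / Mfact n))
  <-> (forall n x m, P n x m = Ptrans n x m).
Proof.
assert (Hnz : forall n, RtoC (Mfact n) <> 0).
{ intros n H; apply RtoC_inj in H; pose proof (Mfact_pos n); lra. }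
split; intros H.
- intros n x m; unfold Ptrans; rewrite H; field; apply Hnz.
- intros x m; apply functional_extensionality; intros n.
  rewrite H; unfold Ptrans; field; apply Hnz.
Qed.

(** Coquelicot's [Series] is real valued; the sum of a complex series is taken
    on real and imaginary parts. *)

Definition CSeries (a : nat -> C) : C :=
  (Series (fun n => Re (a n)), Series (fun n => Im (a n))).

Lemma CSeries_unique (a : nat -> C) (l : C) : is_series a l -> CSeries a = l.
Proof.
intros H.
assert (Hs : forall n, sum_n a n
          = (sum_n (fun k => Re (a k)) n, sum_n (fun k => Im (a k)) n)).
{ intros n; induction n as [|n IH].
  - rewrite !sum_O; apply surjective_pairing.
  - rewrite !sum_Sn, IH; reflexivity. }
assert (Hl : filterlim (fun n => sum_n a n : C) eventually
               (@locally C_UniformSpace l)).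
{ intros Q HQ; apply H, HQ. }
destruct l as [u v]; unfold CSeries; f_equal; apply is_series_unique.
- apply filterlim_ext with (fun n => fst (sum_n a n)).
  { intros n; rewrite Hs; reflexivity. }
  eapply filterlim_comp; [exact Hl|].
  exact (continuous_fst (u : R_UniformSpace) (v : R_UniformSpace)).
- apply filterlim_ext with (fun n => snd (sum_n a n)).
  { intros n; rewrite Hs; reflexivity. }
  eapply filterlim_comp; [exact Hl|].
  exact (continuous_snd (u : R_UniformSpace) (v : R_UniformSpace)).
Qed.

(** [PhiB r lam n x] and [PhiE r lam n x] are the values at the first argument
    [-n]: the natural number [n] stands for its opposite.
    [Binomial.C (m + r - 1) m] is the usual binomial coefficient only for
    [1 <= r]. *)

Definition PhiB (r : nat) (lam : C) (n : nat) (x : C) : C :=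
  CSeries (fun m =>
    RtoC (Binomial.C (m + r - 1) m) * lam ^ m * Ptrans n x m).

Definition PhiE (r : nat) (lam : C) (n : nat) (x : C) : C :=
  CSeries (fun m =>
    (-1) ^ m * RtoC (Binomial.C (m + r - 1) m) * lam ^ m * Ptrans n x m).

(** [is_Mderive f x l] means that D_x f is defined at [x] with value [l]; at
    [0] this includes the existence of the limit. [C_lim] is not used because
    it only approaches the point along a horizontal line. *)

Definition Mquot (f : C -> C) (x : C) : C := (f (2 * x) - f x) / x.

Definition is_Mderive (f : C -> C) (x l : C) : Prop :=
  (x <> 0 -> Mquot f x = l) /\
  (x = 0 -> filterlim (Mquot f) (locally' (RtoC 0)) (locally l)).

(* Main.v *)
Require Import Defs.
From Stdlib Require Import Reals.
From Stdlib Require Import Lra Lia Factorial FunctionalExtensionality.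
From Coquelicot Require Import Coquelicot.
Open Scope C_scope.

(** The coefficient of [t^n] in e_M^{xt} B(t) is, for a fixed series [B], a
    polynomial in [x], and the M-derivative acts on it by the identity
    e_M^{2xt} - e_M^{xt} = x t e_M^{xt}, which holds because
    (2x)^k - x^k = M_k x^k.  So the whole matter is to write the interpolation
    values in this form.  Exchanging the sum over [m] with the finite Cauchy
    product gives
      Phi(-n, x) = M_n! [t^n] e_M^{xt} B(t),
      B(t) = sum_m binom(m+r-1, m) lam^m (e_M^t)^m,
    where [B] is summed coefficient by coefficient ([PhiB_generating]).  The
    difference quotient of Phi(-n, .) at a nonzero point is then exactly M_n
    Phi(-(n-1), .), and at 0 the claim follows from the continuity of a
    polynomial ([is_Mderive_fps_mul_Mexp]).

    The exchange needs the convergence of the coefficients of [B].  The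
    coefficient of [t^j] in (e_M^t)^m is at most s^{-j} (1-s)^{-m} for every
    0 < s < 1, by comparison with the geometric series (1-t)^{-m} at [t = s];
    the binomial coefficient is at most (1-s)^{-m} s^{-(r-1)}, by the binomial
    theorem for (s + (1-s))^{m+r-1}.  For [s] so small that
    |lam| < (1-s)^2, the terms are dominated by a convergent geometric series
    ([ex_series_binom_fps_pow]).

    The Euler-type values are the Bernoulli-type values at [- lam]. *)

(** * The difference equation of the M-exponential *)

Lemma Mfact_neq_0 n : RtoC (Mfact n) <> 0.
Proof.
intros H; apply RtoC_inj in H; pose proof (Mfact_pos n); lra.
Qed.

Lemma Mersenne_neq_0 n : RtoC (Mersenne (S n)) <> 0.
Proof.
intros H; apply RtoC_inj in H.
pose proof (Mersenne_pos (S n) ltac:(lia)); lra.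
Qed.

Lemma Cpow_2_Mersenne (x : C) k : (2 * x) ^ k - x ^ k = Mersenne k * x ^ k.
Proof.
rewrite Cpow_mult_l; unfold Mersenne.
rewrite RtoC_minus, RtoC_pow; ring.
Qed.

Lemma Mexp_double_0 (x : C) : Mexp (2 * x) 0%nat - Mexp x 0%nat = 0.
Proof. unfold Mexp; simpl; ring. Qed.

Lemma Mexp_double_S (x : C) k :
  Mexp (2 * x) (S k) - Mexp x (S k) = x * Mexp x k.
Proof.
unfold Mexp.
replace (RtoC (Mfact (S k))) with (Mersenne (S k) * Mfact k)
  by (rewrite <- RtoC_mult; reflexivity).
transitivity (((2 * x) ^ S k - x ^ S k) / (Mersenne (S k) * Mfact k)).
{ field; split; [apply Mfact_neq_0 | apply Mersenne_neq_0]. }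
rewrite Cpow_2_Mersenne, Cpow_S.
field; split; [apply Mfact_neq_0 | apply Mersenne_neq_0].
Qed.

Lemma fps_mul_sub_l (a b c : fps) n :
  fps_mul a c n - fps_mul b c n = fps_mul (fun k => a k - b k) c n.
Proof.
unfold fps_mul.
assert (H : forall p, sum_n (fun k => a k * c (n - k)%nat) p
    - sum_n (fun k => b k * c (n - k)%nat) p
    = sum_n (fun k => (a k - b k) * c (n - k)%nat) p).
{ induction p as [|p IH].
  - rewrite !sum_O; ring.
  - rewrite !sum_Sn, <- IH; unfold plus; simpl; ring. }
apply H.
Qed.

(** e_M^{2xt} - e_M^{xt} = x t e_M^{xt}, multiplied by a series and read off
    at [t^(n+1)]: the factor [t] lowers the index by one. *)
Lemma fps_mul_Mexp_double_S (b : fps) (x : C) n :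
  fps_mul (Mexp (2 * x)) b (S n) - fps_mul (Mexp x) b (S n)
  = x * fps_mul (Mexp x) b n.
Proof.
rewrite fps_mul_sub_l; unfold fps_mul, sum_n.
rewrite sum_Sn_m by lia.
rewrite Mexp_double_0, <- sum_n_m_S.
rewrite (sum_n_m_ext _ (fun k => mult x (Mexp x k * b (n - k)%nat))).
- change (plus ?u ?v) with (u + v).
  rewrite Cmult_0_l, Cplus_0_l.
  apply (@sum_n_m_mult_l C_Ring).
- intros k; rewrite Mexp_double_S.
  replace (S n - S k)%nat with (n - k)%nat by lia.
  change (x * Mexp x k * b (n - k)%nat = x * (Mexp x k * b (n - k)%nat)).
  ring.
Qed.

(** * Continuity in the variable x *)

Lemma continuous_C_AbsRing_id (x : C) :
  continuous (T := C_UniformSpace) (U := AbsRing_UniformSpace C_AbsRing)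
    (fun y => y) x.
Proof.
intros Q HQ; apply locally_C in HQ; exact HQ.
Qed.

Lemma continuous_Cpow k (x : C) :
  continuous (T := C_UniformSpace) (U := AbsRing_UniformSpace C_AbsRing)
    (fun y : C => y ^ k) x.
Proof.
induction k as [|k IH].
- apply continuous_const.
- apply (continuous_mult (K := C_AbsRing) (fun y : C => y) (fun y : C => y ^ k)).
  + apply continuous_C_AbsRing_id.
  + exact IH.
Qed.

Lemma continuous_fps_mul_Mexp (b : fps) n (x : C) :
  continuous (T := C_UniformSpace) (U := AbsRing_UniformSpace C_AbsRing)
    (fun y => fps_mul (Mexp y) b n) x.
Proof.
assert (H : forall k, continuous (T := C_UniformSpace)
  (U := AbsRing_UniformSpace C_AbsRing)
  (fun y => Mexp y k * b (n - k)%nat) x).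
{ intros k; unfold Mexp, Cdiv.
  apply (continuous_mult (K := C_AbsRing) (fun y => y ^ k * / Mfact k)
           (fun _ => b (n - k)%nat)).
  2: apply continuous_const.
  apply (continuous_mult (K := C_AbsRing) (fun y => y ^ k)
           (fun _ => / Mfact k)).
  - apply continuous_Cpow.
  - apply continuous_const. }
assert (Hs : forall p, continuous (T := C_UniformSpace)
  (U := AbsRing_UniformSpace C_AbsRing)
  (fun y => sum_n (fun k => Mexp y k * b (n - k)%nat) p) x).
{ induction p as [|p IH].
  - eapply continuous_ext; [|exact (H 0%nat)].
    intros y; simpl; now rewrite sum_O.
  - eapply continuous_ext;
      [|exact (continuous_plus (V := AbsRing_NormedModule C_AbsRing)
                 _ _ _ IH (H (S p)))].
    intros y; simpl; now rewrite sum_Sn. }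
apply Hs.
Qed.

(** * The M-derivative of a coefficient of a product with the M-exponential *)

Lemma Mquot_fps_mul_Mexp (b : fps) n (y : C) : y <> 0 ->
  Mquot (fun x => Mfact (S n) * fps_mul (Mexp x) b (S n)) y
  = Mersenne (S n) * (Mfact n * fps_mul (Mexp y) b n).
Proof.
intros Hy; unfold Mquot.
transitivity (Mfact (S n) * (fps_mul (Mexp (2 * y)) b (S n)
                             - fps_mul (Mexp y) b (S n)) / y).
{ field; exact Hy. }
rewrite fps_mul_Mexp_double_S.
replace (RtoC (Mfact (S n))) with (Mersenne (S n) * Mfact n)
  by (rewrite <- RtoC_mult; reflexivity).
field; exact Hy.
Qed.

(** A punctured neighbourhood of 0 sees only the formula for the quotient at
    nonzero points, so that a continuous right-hand side settles [x = 0]. *)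
Lemma is_Mderive_of_quotient (f g : C -> C) (x : C) :
  (forall y : C, y <> 0 -> Mquot f y = g y) ->
  continuous (T := C_UniformSpace) (U := AbsRing_UniformSpace C_AbsRing) g x ->
  is_Mderive f x (g x).
Proof.
intros Hq Hg; split; [apply Hq|].
intros ->.
apply filterlim_within_ext with g.
- intros y Hy; symmetry; apply Hq, Hy.
- eapply filterlim_filter_le_1; [apply filter_le_within|].
  intros Q HQ; apply Hg, locally_C, HQ.
Qed.

Lemma is_Mderive_fps_mul_Mexp (b : fps) n (x : C) :
  is_Mderive (fun y => Mfact (S n) * fps_mul (Mexp y) b (S n)) x
    (Mersenne (S n) * (Mfact n * fps_mul (Mexp x) b n)).
Proof.
apply (is_Mderive_of_quotient _
         (fun y => Mersenne (S n) * (Mfact n * fps_mul (Mexp y) b n))).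
- apply Mquot_fps_mul_Mexp.
- apply (continuous_mult (K := C_AbsRing) (fun _ => RtoC (Mersenne (S n)))
           (fun y => Mfact n * fps_mul (Mexp y) b n)).
  { apply continuous_const. }
  apply (continuous_mult (K := C_AbsRing) (fun _ => RtoC (Mfact n))
           (fun y => fps_mul (Mexp y) b n)).
  + apply continuous_const.
  + apply continuous_fps_mul_Mexp.
Qed.

Lemma is_Mderive_fps_mul_Mexp_0 (b : fps) (x : C) :
  is_Mderive (fun y => Mfact 0 * fps_mul (Mexp y) b 0%nat) x 0.
Proof.
apply (is_Mderive_of_quotient _ (fun _ => 0)).
- intros y Hy; unfold Mquot, fps_mul, Mexp.
  rewrite !sum_O; simpl; field; exact Hy.
- apply continuous_const.
Qed.

(** * Geometric bounds *)

Lemma Cmod_sum_n_geom (a : nat -> C) (s D : R) n : (s < 1)%R ->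
  (forall k, (k <= n)%nat -> (Cmod (a k) <= D * s ^ k)%R) ->
  (Cmod (sum_n a n) * (1 - s) <= D * (1 - s ^ S n))%R.
Proof.
intros Hs; induction n as [|n IH]; intros H.
- rewrite sum_O; specialize (H 0%nat (le_n _)); simpl in *; nra.
- rewrite sum_Sn.
  assert (H1 : (Cmod (sum_n a n) * (1 - s) <= D * (1 - s ^ S n))%R)
    by (apply IH; intros; apply H; lia).
  specialize (H (S n) (le_n _)).
  pose proof (Cmod_triangle (sum_n a n) (a (S n))) as H2.
  change (plus ?u ?v) with (u + v).
  replace (s ^ S (S n))%R with (s * s ^ S n)%R by reflexivity.
  nra.
Qed.

(** If all coefficients of [a] are at most 1 in modulus, then those of [a^m]
    are at most those of (1-t)^{-m}, and a power series with nonnegative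
    coefficients bounds each of its terms at [t = s]. *)
Lemma Cmod_fps_pow_le (a : fps) (s : R) m j : (0 < s < 1)%R ->
  (forall k, (Cmod (a k) <= 1)%R) ->
  (Cmod (fps_pow a m j) <= / (s ^ j * (1 - s) ^ m))%R.
Proof.
intros Hs Ha; revert j; induction m as [|m IH]; intros j.
- assert (Hp : (0 < s ^ j <= 1)%R).
  { split; [apply pow_lt; lra|].
    rewrite <- (pow1 j); apply pow_incr; lra. }
  assert (H1 : (1 <= / (s ^ j * (1 - s) ^ 0))%R).
  { simpl; rewrite Rmult_1_r, <- Rinv_1; apply Rinv_le_contravar; lra. }
  destruct j; simpl fps_pow; unfold fps_one.
  + rewrite Cmod_1; exact H1.
  + rewrite Cmod_0; lra.
- assert (Hj : (0 < s ^ j)%R) by (apply pow_lt; lra).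
  assert (Hm : (0 < (1 - s) ^ m)%R) by (apply pow_lt; lra).
  assert (HD : (0 < / (s ^ j * (1 - s) ^ m))%R)
    by (apply Rinv_0_lt_compat; nra).
  assert (H : (Cmod (fps_pow a (S m) j) * (1 - s)
               <= / (s ^ j * (1 - s) ^ m) * (1 - s ^ S j))%R).
  { apply Cmod_sum_n_geom; [lra|].
    intros k Hk; rewrite Cmod_mult.
    assert (Hsk : (0 < s ^ k)%R) by (apply pow_lt; lra).
    assert (Hsjk : (0 < s ^ (j - k))%R) by (apply pow_lt; lra).
    replace (/ (s ^ j * (1 - s) ^ m) * s ^ k)%R
      with (/ (s ^ (j - k) * (1 - s) ^ m))%R.
    - rewrite <- (Rmult_1_l (/ _)).
      apply Rmult_le_compat; try apply Cmod_ge_0; [apply Ha | apply IH].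
    - replace (s ^ j)%R with (s ^ (j - k) * s ^ k)%R
        by (rewrite <- pow_add; f_equal; lia).
      field; lra. }
  assert (Hsj : (0 < s ^ S j)%R) by (apply pow_lt; lra).
  replace (/ (s ^ j * (1 - s) ^ S m))%R
    with (/ (s ^ j * (1 - s) ^ m) / (1 - s))%R by (simpl; field; lra).
  apply Rle_div_r; [lra|]; nra.
Qed.

Lemma Mfact_ge_1 n : (1 <= Mfact n)%R.
Proof.
induction n as [|n IH]; [simpl; lra|].
assert (H : (1 <= Mersenne (S n))%R).
{ unfold Mersenne; pose proof (pow_R1_Rle 2 n ltac:(lra)); simpl; lra. }
simpl; nra.
Qed.

Lemma Cmod_Mexp_1_le k : (Cmod (Mexp 1 k) <= 1)%R.
Proof.
unfold Mexp; rewrite Cpow_1_l.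
pose proof (Mfact_ge_1 k) as H.
rewrite Cmod_div by apply Mfact_neq_0.
rewrite Cmod_1, Cmod_R, Rabs_pos_eq by lra.
apply Rle_div_l; lra.
Qed.

Lemma Binomial_C_pos n k : (0 < Binomial.C n k)%R.
Proof.
unfold Binomial.C.
apply Rdiv_lt_0_compat; [|apply Rmult_lt_0_compat]; apply INR_fact_lt_0.
Qed.

(** One term of the binomial expansion of (u + v)^(m+q), with [u + v = 1]. *)
Lemma Binomial_C_pow_le_1 (u v : R) q m : (0 <= u)%R -> (0 <= v)%R ->
  (u + v = 1)%R -> (Binomial.C (m + q) m * u ^ m * v ^ q <= 1)%R.
Proof.
intros Hu Hv Huv.
assert (Hpow : forall w k, (0 <= w)%R -> (w <= 1)%R -> (w ^ k <= 1)%R).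
{ intros w k H0 H1; rewrite <- (pow1 k); apply pow_incr; lra. }
revert m; induction q as [|q IHq]; intros m.
- rewrite Nat.add_0_r; unfold Binomial.C; rewrite Nat.sub_diag; simpl fact.
  replace (INR (fact m) / (INR (fact m) * INR 1))%R with 1%R
    by (simpl; field; apply INR_fact_neq_0).
  pose proof (Hpow u m Hu ltac:(lra)); simpl; lra.
- induction m as [|m IHm].
  + unfold Binomial.C; rewrite Nat.sub_0_r; simpl (0 + S q)%nat.
    replace (INR (fact (S q)) / (INR (fact 0) * INR (fact (S q))))%R with 1%R
      by (simpl (fact 0); simpl (INR 1); field; apply INR_fact_neq_0).
    pose proof (Hpow v (S q) Hv ltac:(lra)).
    rewrite pow_O; lra.
  + replace (S m + S q)%nat with (S (m + S q)) by lia.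
    rewrite <- pascal by lia.
    specialize (IHq (S m)).
    replace (S m + q)%nat with (m + S q)%nat in IHq by lia.
    (* Pascal's rule turns the bound into [u * 1 + v * 1]. *)
    replace ((Binomial.C (m + S q) m + Binomial.C (m + S q) (S m))
             * u ^ S m * v ^ S q)%R
      with (u * (Binomial.C (m + S q) m * u ^ m * v ^ S q)
            + v * (Binomial.C (m + S q) (S m) * u ^ S m * v ^ q))%R
      by (simpl; ring).
    nra.
Qed.

(** * The interpolation values as coefficients of a generating function *)

Lemma ex_series_binom_fps_pow (r : nat) (lam : C) j : (1 <= r)%nat ->
  (Cmod lam < 1)%R ->
  ex_series (V := C_NormedModule) (fun m =>
    RtoC (Binomial.C (m + r - 1) m) * lam ^ m * fps_pow (Mexp 1) m j).
Proof.
intros Hr Hlam.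
pose proof (Cmod_ge_0 lam) as Hl0.
set (l := Cmod lam) in *.
(* Half of 1 - |lam|, for which (1-s)^2 = |lam| + s^2. *)
set (s := ((1 - l) / 2)%R).
assert (Hs : (0 < s < 1)%R) by (unfold s; lra).
assert (Hq : (l / ((1 - s) * (1 - s)) < 1)%R).
{ apply Rlt_div_l; unfold s; nra. }
set (th := (l / ((1 - s) * (1 - s)))%R) in *.
assert (Hth0 : (0 <= th)%R).
{ unfold th; apply Rdiv_le_0_compat; nra. }
set (K := (/ s ^ (r - 1) * / s ^ j)%R).
apply (ex_series_le (V := C_CompleteNormedModule)) with (fun m => (K * th ^ m)%R).
2:{ apply (ex_series_scal (V := R_NormedModule) K).
    apply ex_series_geom; rewrite Rabs_pos_eq; lra. }
intros m; change (norm ?z) with (Cmod z).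
rewrite !Cmod_mult, Cmod_pow; fold l.
rewrite Cmod_R, Rabs_pos_eq by (left; apply Binomial_C_pos).
assert (Hb : (Binomial.C (m + r - 1) m <= / ((1 - s) ^ m * s ^ (r - 1)))%R).
{ pose proof (Binomial_C_pow_le_1 (1 - s) s (r - 1) m
                ltac:(lra) ltac:(lra) ltac:(lra)) as H.
  replace (m + (r - 1))%nat with (m + r - 1)%nat in H by lia.
  rewrite <- Rdiv_1_l; apply (Rle_div_r (Binomial.C _ _)); [|lra].
  apply Rmult_lt_0_compat; apply pow_lt; lra. }
pose proof (Cmod_fps_pow_le (Mexp 1) s m j Hs Cmod_Mexp_1_le) as He.
assert (Hlm : (0 <= l ^ m)%R) by (apply pow_le; lra).
pose proof (Binomial_C_pos (m + r - 1) m) as Hb0.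
pose proof (Cmod_ge_0 (fps_pow (Mexp 1) m j)) as He0.
apply Rle_trans with
  (/ ((1 - s) ^ m * s ^ (r - 1)) * l ^ m * / (s ^ j * (1 - s) ^ m))%R.
- apply Rmult_le_compat; [nra | exact He0 | nra | exact He].
- right; unfold K, th, Rdiv.
  rewrite Rpow_mult_distr, pow_inv, Rpow_mult_distr.
  field; repeat split; apply pow_nonzero; lra.
Qed.

(** The series (1 - lam e_M^t)^{-r}, expanded in powers of [lam e_M^t]; as
    e_M^t has constant term 1, each coefficient is an infinite sum. *)
Definition binom_fps (r : nat) (lam : C) : fps := fun j =>
  CSeries (fun m =>
    RtoC (Binomial.C (m + r - 1) m) * lam ^ m * fps_pow (Mexp 1) m j).

(** A Cauchy product is a finite sum, so it commutes with a sum of series that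
    converges coefficientwise. *)
Lemma is_series_fps_mul (a b : fps) (c : nat -> C) (u : nat -> fps) n :
  (forall j, is_series (V := C_NormedModule) (fun m => c m * u m j) (b j)) ->
  is_series (V := C_NormedModule)
    (fun m => c m * fps_mul a (u m) n) (fps_mul a b n).
Proof.
intros H; unfold fps_mul.
assert (Hk : forall k, is_series (V := C_NormedModule)
  (fun m => c m * (a k * u m (n - k)%nat)) (a k * b (n - k)%nat)).
{ intros k.
  eapply is_series_ext;
    [|exact (is_series_scal_l (V := C_NormedModule) (a k) _ _
               (H (n - k)%nat))].
  intros m; simpl; change (scal ?v ?w) with (v * w); ring. }
assert (Hp : forall p, is_series (V := C_NormedModule)
  (fun m => c m * sum_n (fun k => a k * u m (n - k)%nat) p)
  (sum_n (fun k => a k * b (n - k)%nat) p)).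
{ induction p as [|p IH].
  - rewrite sum_O; eapply is_series_ext; [|exact (Hk 0%nat)].
    intros m; simpl; now rewrite sum_O.
  - rewrite sum_Sn; eapply is_series_ext;
      [|exact (is_series_plus (V := C_NormedModule) _ _ _ _ IH (Hk (S p)))].
    intros m; simpl; rewrite sum_Sn.
    change (plus ?v ?w) with (v + w); ring. }
apply Hp.
Qed.

Lemma PhiB_generating (r : nat) (lam : C) n (x : C) : (1 <= r)%nat ->
  (Cmod lam < 1)%R ->
  PhiB r lam n x = Mfact n * fps_mul (Mexp x) (binom_fps r lam) n.
Proof.
intros Hr Hlam; unfold PhiB; apply CSeries_unique.
assert (H : forall j, is_series (V := C_NormedModule) (fun m =>
    RtoC (Binomial.C (m + r - 1) m) * lam ^ m * fps_pow (Mexp 1) m j)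
    (binom_fps r lam j)).
{ intros j; destruct (ex_series_binom_fps_pow r lam j Hr Hlam) as [z Hz].
  unfold binom_fps; rewrite (CSeries_unique _ _ Hz); exact Hz. }
eapply is_series_ext;
  [|exact (is_series_scal_l (V := C_NormedModule) (RtoC (Mfact n)) _ _
             (is_series_fps_mul (Mexp x) _ _ _ n H))].
intros m; simpl; unfold Ptrans.
change (scal ?v ?w) with (v * w); ring.
Qed.

Lemma PhiE_PhiB (r : nat) (lam : C) n : PhiE r lam n = PhiB r (- lam) n.
Proof.
apply functional_extensionality; intros x; unfold PhiE, PhiB; f_equal.
apply functional_extensionality; intros m.
replace (- lam) with (-1 * lam) by ring.
rewrite Cpow_mult_l; ring.
Qed.

Lemma is_Mderive_PhiB_S (r : nat) (lam : C) n (x : C) : (1 <= r)%nat ->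
  (Cmod lam < 1)%R ->
  is_Mderive (PhiB r lam (S n)) x (Mersenne (S n) * PhiB r lam n x).
Proof.
intros Hr Hlam.
replace (PhiB r lam (S n)) with
  (fun y => Mfact (S n) * fps_mul (Mexp y) (binom_fps r lam) (S n)).
- rewrite PhiB_generating by assumption; apply is_Mderive_fps_mul_Mexp.
- apply functional_extensionality; intros y.
  now rewrite PhiB_generating by assumption.
Qed.

Lemma is_Mderive_PhiB_0 (r : nat) (lam x : C) : (1 <= r)%nat ->
  (Cmod lam < 1)%R -> is_Mderive (PhiB r lam 0) x 0.
Proof.
intros Hr Hlam.
replace (PhiB r lam 0) with
  (fun y => Mfact 0 * fps_mul (Mexp y) (binom_fps r lam) 0%nat).
- apply is_Mderive_fps_mul_Mexp_0.
- apply functional_extensionality; intros y.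
  now rewrite PhiB_generating by assumption.
Qed.

Theorem theorem7p1 (r : nat) (x lam : C) (hr : (1 <= r)%nat)
    (hlam : (Cmod lam < 1)%R) :
  (forall n : nat, (1 <= n)%nat ->
     is_Mderive (PhiB r lam n) x (Mersenne n * PhiB r lam (n - 1) x) /\
     is_Mderive (PhiE r lam n) x (Mersenne n * PhiE r lam (n - 1) x)) /\
  (is_Mderive (PhiB r lam 0) x 0 /\
   is_Mderive (PhiE r lam 0) x 0).
Proof.
assert (hneg : (Cmod (- lam) < 1)%R) by (rewrite Cmod_opp; exact hlam).
split; [intros n hn | split].
- destruct n as [|n]; [lia|].
  replace (S n - 1)%nat with n by lia.
  rewrite !PhiE_PhiB; split; apply is_Mderive_PhiB_S; assumption.
- apply is_Mderive_PhiB_0; assumption.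
- rewrite PhiE_PhiB; apply is_Mderive_PhiB_0; assumption.
Qed.
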